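(* Let $\mathcal{T}:\mathcal{H}\to\mathcal{H}$ be a compact linear operator, let $J:\Omega\to\mathbb{R}_+$ be of class $\mathcal{C}^1$, convex and $2$-convex, and let $\tau\ge1$ be fixed. For each sufficiently small $\delta\in(0,1)$ let $f^\delta\in\mathcal{H}$ satisfy $\|f^\delta-f^\dagger\|\le\delta$, where $f^\dagger=\mathcal{T}\varphi^\dagger$, let $G_\delta(\varphi,f^\delta):=\frac12\|\mathcal{T}\varphi-f^\delta\|^2$, and assume that $G_\delta(\cdot,f^\delta)$ is $2$-convex with constants $c_{f^\delta}$ for which there are numbers $c_\delta$ and $\underline{c}$ with $0<c_\delta\le c_{f^\delta}$ and $0<\underline{c}\le c_\delta$ for all such $\delta$. Consider the Bregman divergence associated with the misfit term, $$D_{G_\delta}(\varphi_{\alpha(\delta)},\varphi^\dagger)=\tfrac12\|\mathcal{T}\varphi_{\alpha(\delta)}-f^\delta\|^2-\tfrac12\|\mathcal{T}\varphi^\dagger-f^\delta\|^2-\langle\nabla G_\delta(\varphi^\dagger,f^\delta),\varphi_{\alpha(\delta)}-\varphi^\dagger\rangle .$$ If $\varphi_{\alpha(\delta)}$ is the regularized solution for the regularization parameter $\alpha(\delta):=\sqrt{\delta}\,(\tau+1)\,\|\mathcal{T}^*\|$, satisfying $\|\mathcal{T}\varphi_{\alpha(\delta)}-f^\delta\|\le\tau\delta$, then for sufficiently small $\delta\in(0,1)$ $$D_{G_\delta}(\varphi_{\alpha(\delta)},\varphi^\dagger)\le\mathcal{O}(\delta^{3/2}),$$ and this rate implies $$\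|\varphi_{\alpha(\delta)}-\varphi^\dagger\|\le\mathcal{O}(\delta^{3/4}).$$
   Context: $\mathcal{H}$ is a (real) Hilbert space, $\Omega\subset\mathcal{H}$ is compact and convex, and $\mathcal{T}$ is linear, compact and injective with adjoint $\mathcal{T}^*$. The true solution $\varphi^\dagger\in\Omega$ satisfies $\mathcal{T}\varphi^\dagger=f^\dagger$. For $\alpha>0$, the cost functional is $F_\alpha(\varphi,f^\delta):=\frac12\|\mathcal{T}\varphi-f^\delta\|^2+\alpha J(\varphi)$. The regularized solution $\varphi_{\alpha}$ is the minimizer of $F_\alpha(\cdot,f^\delta)$ over $\Omega$; it is a standing assumption that it satisfies the first order optimality condition $\mathcal{T}^*(f^\delta-\mathcal{T}\varphi_\alpha)=\alpha\nabla J(\varphi_\alpha)$. For a smooth convex functional $\Phi$, the Bregman divergence is $D_\Phi(u,u^* ):=\Phi(u)-\Phi(u^* )-\langle\nabla\Phi(u^* ),u-u^*\rangle$. $\Phi$ is called $2$-convex in $u^*$ if for all $M>0$ there exists $c^*>0$ such that $D_\Phi(u,u^* )\ge c^*\|u-u^*\|^2$ whenever $\|u-u^*\|\le M$; it is called $2$-convex if this holds at every $u^*$ in its domain. The constant $c_{f^\delta}>0$ is the ($2$-)convexity modulus of $G_\delta(\cdot,f^\delta)$, i.e. $D_{G_\delta}(\varphi,\varphi^\dagger)\ge c_{f^\delta}\|\varphi-\varphi^\dagger\|^2$ for $\varphi\in\Omega$. The $\mathcal{O}$ symbols are for $\delta\to0$. *)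

(* Defs.v *)
From HB Require Import structures.
From mathcomp Require Import all_boot all_order all_algebra.
From mathcomp Require Import sesquilinear.
From mathcomp Require Import all_classical all_reals all_analysis.

Set Implicit Arguments.
Unset Strict Implicit.
Unset Printing Implicit Defensive.

Import Order.TTheory GRing.Theory Num.Theory.
Import numFieldNormedType.Exports.

Local Open Scope classical_set_scope.
Local Open Scope ring_scope.

HB.mixin Record isHilbert (R : realType) H of CompleteNormedModule R H := {
  inner : {dot H for (idfun : R -> R)} ;
  innerE : forall x : H, inner x x = `|x| ^+ 2
}.

#[short(type=hilbertType)]
HB.structure Definition Hilbert (R : realType) :=
  {H of isHilbert R H & CompleteNormedModule R H}.

Section operators.
Context {R : realType} {H : hilbertType R}.

Definition compact_operator (T : H -> H) :=
  forall B : set H, bounded_set B -> precompact (T @` B).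

Definition is_adjoint (T Ts : H -> H) :=
  forall x y : H, inner (T x) y = inner x (Ts y).

(* Meaningful for bounded [T]; the [sup] of an unbounded set is a junk value. *)
Definition opnorm (T : H -> H) : R :=
  sup [set `|T x| | x in [set x : H | `|x| <= 1]].

End operators.

Section gradients.
Context {R : realType} {H : hilbertType R}.
Implicit Types (A : set H) (Phi : H -> R) (dPhi : H -> H).

(* [g] represents the derivative at [u] of the restriction of [Phi] to [A].
   When [A] has empty interior there may be several such [g], but they agree on
   all directions [v - u] with [v] in [A] if [A] is convex. *)
Definition gradient_within A Phi (u g : H) :=
  forall e : R, 0 < e -> \forall v \near within A (nbhs u),
    `|Phi v - Phi u - inner g (v - u)| <= e * `|v - u|.

(* Meaningful at the points where [Phi] is Frechet differentiable on [H]. *)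
Definition gradient Phi (u : H) : H :=
  xget 0 [set g | gradient_within setT Phi u g].

Definition C1_on A Phi dPhi :=
  (forall u, A u -> gradient_within A Phi u (dPhi u)) /\
  {within A, continuous dPhi}.

Definition bregman Phi dPhi (u v : H) : R :=
  Phi u - Phi v - inner (dPhi v) (u - v).

Definition two_convex_at A Phi dPhi (v : H) :=
  forall M : R, 0 < M -> exists2 c : R, 0 < c &
    forall u, A u -> `|u - v| <= M -> c * `|u - v| ^+ 2 <= bregman Phi dPhi u v.

Definition two_convex A Phi dPhi :=
  forall v, A v -> two_convex_at A Phi dPhi v.

End gradients.

Section tikhonov.
Context {R : realType} {H : hilbertType R}.

Definition misfit (T : H -> H) (f phi : H) : R := 2^-1 * `|T phi - f| ^+ 2.

Definition misfit_divergence (T : H -> H) (f u v : H) : R :=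
  bregman (misfit T f) (gradient (misfit T f)) u v.

Definition cost (T : H -> H) (J : H -> R) (alpha : R) (f phi : H) : R :=
  misfit T f phi + alpha * J phi.

Definition regularized_solution (Omega : set H) (T : H -> H) (J : H -> R)
    (alpha : R) (f phi : H) :=
  Omega phi /\
  forall psi, Omega psi -> cost T J alpha f phi <= cost T J alpha f psi.

Definition first_order_condition (T Ts : H -> H) (dJ : H -> H)
    (alpha : R) (f phi : H) :=
  Ts (f - T phi) = alpha *: dJ phi.

End tikhonov.

(* Main.v *)
(* The misfit is quadratic, so its Bregman divergence is exactly
   D(u, v) = ||T (u - v)||^2 / 2.  By the triangle inequality through f^delta,
   the noise bound and the discrepancy bound give
   ||T (phi_delta - phi^dagger)|| <= (tau + 1) delta, hence a divergence of order
   delta^2, which is at most delta^(3/2) for delta <= 1.  The uniform convexity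
   modulus then converts this into the rate delta^(3/4) for the error.  As
   [gradient] is a choice of derivative, the formula for D needs that T is
   bounded (from compactness) and that the gradient is unique. *)

Require Import Defs.
From HB Require Import structures.
From mathcomp Require Import all_boot all_order all_algebra.
From mathcomp Require Import sesquilinear.
From mathcomp Require Import all_classical all_reals all_analysis.
From mathcomp Require Import ring lra.

Import Order.TTheory GRing.Theory Num.Theory.
Import numFieldNormedType.Exports.

Local Open Scope classical_set_scope.
Local Open Scope ring_scope.

Lemma innerC (R : realType) (H : hilbertType R) (x y : H) :
  inner x y = inner y x.
Proof. by rewrite (hermC inner) expr0 mul1r. Qed.

Lemma sqr_normD (R : realType) (H : hilbertType R) (x y : H) :
  `|x + y| ^+ 2 = `|x| ^+ 2 + 2 * inner x y + `|y| ^+ 2.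
Proof.
rewrite -!innerE linearDl !linearDr /= (innerC _ _ y x).
by ring.
Qed.

Lemma gradient_within_unique (R : realType) (H : hilbertType R)
    (Phi : H -> R) (u g1 g2 : H) :
  gradient_within setT Phi u g1 -> gradient_within setT Phi u g2 -> g1 = g2.
Proof.
(* At [v = u + t *: w], the two expansions force [t * `|w|^2 <= t * `|w|^2 / 2]. *)
move=> grad1 grad2; apply/eqP; rewrite -subr_eq0.
apply/negPn/negP; rewrite -normr_gt0; set w := g1 - g2 => w_gt0.
have e_gt0 : 0 < `|w| / 4 by rewrite divr_gt0.
have : nbhs u (fun v => setT v ->
    `|Phi v - Phi u - inner g1 (v - u)| <= `|w| / 4 * `|v - u| /\
    `|Phi v - Phi u - inner g2 (v - u)| <= `|w| / 4 * `|v - u|).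
  exact: filterI (grad1 _ e_gt0) (grad2 _ e_gt0).
move=> /nbhs_ballP [d /= d_gt0 near_u].
(* This scaling gives [t *: w] norm [d / 2], so [u + t *: w] stays in the ball of radius [d] where
   both expansions hold. *)
set t := d / (2 * `|w|); have t_gt0 : 0 < t by rewrite divr_gt0 ?mulr_gt0.
have norm_tw : `|t *: w| = d / 2.
  by rewrite normrZ gtr0_norm // /t; field; rewrite gt_eqF.
have [] : [/\ `|Phi (u + t *: w) - Phi u - inner g1 (t *: w)| <=
              `|w| / 4 * (d / 2) &
            `|Phi (u + t *: w) - Phi u - inner g2 (t *: w)| <=
              `|w| / 4 * (d / 2)].
  have [] // := near_u (u + t *: w).
    rewrite -ball_normE /= opprD addNKr normrN norm_tw; lra.
  by rewrite [u + _]addrC addrK norm_tw.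
rewrite !ler_norml => /andP[lo1 _] /andP[_ hi2].
have inner_w : inner w (t *: w) = inner g1 (t *: w) - inner g2 (t *: w).
  by rewrite {1}/w linearBl.
have : inner w (t *: w) = `|w| * (d / 2).
  rewrite linearZ /= innerE /t; field; rewrite gt_eqF //.
have : 0 < `|w| * (d / 2) by rewrite !mulr_gt0.
lra.
Qed.

(** The image of the unit ball has compact, hence bounded, closure. So [T] is bounded near 0, and
    linearity turns this into a global Lipschitz bound. *)
Lemma compact_operator_bounded (R : realType) (H : hilbertType R)
    (T : {linear H -> H}) :
  compact_operator T -> exists2 k, 0 < k & forall x, `|T x| <= k * `|x|.
Proof.
move=> T_compact.
have ball_bounded : bounded_set [set x : H | `|x| <= 1].
  by exists 1; split=> // M M1 x /= x1; rewrite (le_trans x1) // ltW.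
have /T_compact := ball_bounded; rewrite precompactE => /compact_bounded.
move=> [M [Mreal TM]].
have /linear_boundedP [N [_ TN]] : bounded_near T (nbhs (0 : H)).
  exists M; split=> // K MK; near=> x.
  have x_le1 : `|x| <= 1 by near: x; exact: nbhs0_le.
  by apply: (TM K MK); apply: subset_closure; exists x.
(* [N] may be negative and only constants strictly above it are admissible; [|N| + 1] is both
   positive and above [N]. *)
exists (`|N| + 1) => [|x]; first by rewrite ltr_wpDl.
by apply: TN; rewrite (le_lt_trans (ler_norm N)) // ltrDl.
Unshelve. all: by end_near. Qed.

(** Expand the square of [T (v - u) + (T u - f)]: the adjoint turns the cross term into the linear
    term. This exact remainder serves both to differentiate the misfit and to evaluate its
    divergence. *)
Lemma misfit_remainderE (R : realType) (H : hilbertType R)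
    (T : {linear H -> H}) (Ts : H -> H) (f u v : H) :
  is_adjoint T Ts ->
  misfit T f v - misfit T f u - inner (Ts (T u - f)) (v - u) =
  2^-1 * `|T (v - u)| ^+ 2.
Proof.
move=> adj; rewrite innerC -adj /misfit.
have -> : T v - f = T (v - u) + (T u - f) by rewrite linearB /= addrA subrK.
by rewrite (sqr_normD _ _ (T (v - u))); field.
Qed.

Lemma powR_3_2E (R : realType) (x : R) :
  0 <= x -> x `^ (3 / 2) = (x `^ (3 / 4)) ^+ 2.
Proof.
move=> x0; rewrite -powR_mulrn ?powR_ge0 // -powRrM.
by congr (_ `^ _); field.
Qed.

Lemma gradient_misfit (R : realType) (H : hilbertType R)
    (T : {linear H -> H}) (Ts : H -> H) (f u : H) :
  compact_operator T -> is_adjoint T Ts ->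
  gradient (misfit T f) u = Ts (T u - f).
Proof.
move=> /compact_operator_bounded [k k_gt0 Tk] adj.
have grad : gradient_within setT (misfit T f) u (Ts (T u - f)).
  move=> e e_gt0; rewrite near_withinE; near=> v => _.
  rewrite misfit_remainderE // ger0_norm ?mulr_ge0 ?sqr_ge0 //.
  (* On this radius the remainder, at most [k ^+ 2 * |v - u| ^+ 2 / 2], is below [e * |v - u|]. *)
  have small : `|v - u| <= 2 * e / k ^+ 2.
    near: v; apply: cvgr_distC_le; first exact: cvg_id.
    by rewrite divr_gt0 ?mulr_gt0 ?exprn_gt0.
  have Tsq : `|T (v - u)| ^+ 2 <= (k * `|v - u|) ^+ 2.
    by rewrite lerXn2r ?nnegrE ?mulr_ge0 // ltW.
  rewrite ler_pdivrMl //; apply: le_trans Tsq _.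
  have -> : (k * `|v - u|) ^+ 2 = `|v - u| * (`|v - u| * k ^+ 2) by ring.
  have -> : 2 * (e * `|v - u|) = `|v - u| * (2 * e) by ring.
  rewrite ler_wpM2l // -ler_pdivlMr ?exprn_gt0 //.
by apply: xget_unique => // g /gradient_within_unique; apply.
Unshelve. all: by end_near. Qed.

Lemma misfit_divergenceE (R : realType) (H : hilbertType R)
    (T : {linear H -> H}) (Ts : H -> H) (f u v : H) :
  compact_operator T -> is_adjoint T Ts ->
  misfit_divergence T f u v = 2^-1 * `|T (u - v)| ^+ 2.
Proof.
move=> T_compact adj.
by rewrite /misfit_divergence /bregman (gradient_misfit R H T Ts) //
  misfit_remainderE.
Qed.

Theorem theorem4p2 (R : realType) (H : hilbertType R)
  (Omega : set H) (T : {linear H -> H}) (Ts : H -> H)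
  (J : H -> R) (dJ : H -> H) (tau : R)
  (phid fd : H) (f : R -> H) (cf c : R -> R) (cmin : R)
  (alpha : R -> R) (phi : R -> H)
  (Omega_compact : compact Omega)
  (Omega_convex : convex_set Omega)
  (T_compact : compact_operator T)
  (T_inj : injective T)
  (Ts_adjoint : is_adjoint T Ts)
  (phid_Omega : Omega phid)
  (T_phid : T phid = fd)
  (J_ge0 : forall u, Omega u -> 0 <= J u)
  (J_C1 : C1_on Omega J dJ)
  (J_convex : convex_function Omega J)
  (J_two_convex : two_convex Omega J dJ)
  (tau_ge1 : 1 <= tau)
  (noise : \forall delta \near 0^'+, `|f delta - fd| <= delta)
  (G_two_convex : \forall delta \near 0^'+,
    two_convex Omega (misfit T (f delta)) (gradient (misfit T (f delta))))
  (G_modulus : \forall delta \near 0^'+, forall u, Omega u ->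
    cf delta * `|u - phid| ^+ 2 <= misfit_divergence T (f delta) u phid)
  (cmin_gt0 : 0 < cmin)
  (c_bounds : \forall delta \near 0^'+,
    [/\ 0 < c delta, c delta <= cf delta & cmin <= c delta])
  (alphaE : forall delta, alpha delta = Num.sqrt delta * (tau + 1) * opnorm Ts)
  (phi_min : \forall delta \near 0^'+,
    regularized_solution Omega T J (alpha delta) (f delta) (phi delta))
  (phi_first_order : \forall delta \near 0^'+,
    first_order_condition T Ts dJ (alpha delta) (f delta) (phi delta))
  (discrepancy : \forall delta \near 0^'+,
    `|T (phi delta) - f delta| <= tau * delta) :
  (fun delta : R => misfit_divergence T (f delta) (phi delta) phid)
    =O_ (0^'+) (fun delta : R => delta `^ (3 / 2)) /\
  (fun delta : R => `|phi delta - phid|)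
    =O_ (0^'+) (fun delta : R => delta `^ (3 / 4)).
Proof.
have tau1_gt0 : 0 < tau + 1 by lra.
(* The constant is kept explicit because the error estimate reuses it. *)
have divergence_le : \forall delta \near 0^'+,
    misfit_divergence T (f delta) (phi delta) phid <=
    2^-1 * (tau + 1) ^+ 2 * delta `^ (3 / 2).
  near=> delta.
  have delta_gt0 : 0 < delta by near: delta; exact: nbhs_right_gt.
  have delta_le1 : delta <= 1 by near: delta; exact: nbhs_right_le.
  have noise_d : `|f delta - fd| <= delta by near: delta; exact: noise.
  have disc_d : `|T (phi delta) - f delta| <= tau * delta.
    by near: delta; exact: discrepancy.
  rewrite (misfit_divergenceE R H T Ts) //.
  rewrite -mulrA ler_pM2l // linearB /= T_phid.
  have -> : T (phi delta) - fd = (T (phi delta) - f delta) + (f delta - fd).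
    by rewrite addrA subrK.
  apply: (@le_trans _ _ (((tau + 1) * delta) ^+ 2)).
    rewrite lerXn2r ?nnegrE ?mulr_ge0 ?(ltW delta_gt0) ?(ltW tau1_gt0) //.
    by rewrite (le_trans (ler_normD _ _)) // mulrDl mul1r lerD.
  rewrite exprMn ler_wpM2l ?sqr_ge0 // -powR_mulrn ?(ltW delta_gt0) //.
  by apply: ger_powR; [rewrite delta_gt0 | lra].
split; apply/eqO_exP.
  exists (2^-1 * (tau + 1) ^+ 2) ; first by rewrite mulr_gt0 ?exprn_gt0.
  near=> delta.
  rewrite ger0_norm; last first.
    by rewrite (misfit_divergenceE R H T Ts) // mulr_ge0 ?sqr_ge0.
  rewrite ger0_norm ?powR_ge0 //.
  by near: delta.
(* Obtained by dividing the divergence bound by the uniform modulus [cmin] and taking the square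
   root. *)
exists (Num.sqrt (2^-1 * (tau + 1) ^+ 2 / cmin)).
  by rewrite sqrtr_gt0 divr_gt0 ?mulr_gt0 ?exprn_gt0.
near=> delta.
have delta_gt0 : 0 < delta by near: delta; exact: nbhs_right_gt.
have div_le : misfit_divergence T (f delta) (phi delta) phid <=
    2^-1 * (tau + 1) ^+ 2 * delta `^ (3 / 2) by near: delta.
have [phi_Omega _] : regularized_solution Omega T J (alpha delta) (f delta) (phi delta).
  by near: delta.
have [_ c_cf cmin_c] : [/\ 0 < c delta, c delta <= cf delta & cmin <= c delta].
  by near: delta.
have modulus : forall u, Omega u ->
    cf delta * `|u - phid| ^+ 2 <= misfit_divergence T (f delta) u phid.
  by near: delta.
rewrite normr_id [`|_ `^ _|]ger0_norm ?powR_ge0 //.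
(* Both sides are nonnegative, so it suffices to compare squares, which brings back the exponent
   [3 / 2]. *)
rewrite -(@ler_pXn2r _ 2) ?nnegrE ?mulr_ge0 ?sqrtr_ge0 ?powR_ge0 //.
rewrite exprMn sqr_sqrtr; last by rewrite divr_ge0 ?mulr_ge0 ?sqr_ge0 // ltW.
rewrite -powR_3_2E ?(ltW delta_gt0) // mulrAC ler_pdivlMr //.
apply: le_trans div_le; apply: le_trans (modulus _ phi_Omega).
by rewrite mulrC ler_wpM2r ?sqr_ge0 // (le_trans cmin_c).
Unshelve. all: by end_near. Qed.
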